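(* Let $R=(R,+,\cdot)$ be an upper bound semiring, let $U$ be an almost subtractive submonoid of $(R,+)$, let $V$ be an arbitrary $R$-module, and let $q:V\to R$ be a quadratic form with $q(V)\subseteq U$. Then $q$ is rigid, i.e. $q$ has exactly one companion $b$, and this unique companion $b$ is balanced, i.e. $b(x,x)=2q(x)$ for all $x\in V$.
   Context: A semiring $R=(R,+,\cdot)$ is a set such that $(R,+)$ and $(R,\cdot)$ are abelian monoids with identity elements $0$ and $1$, multiplication distributes over addition, and $0\cdot a=0$ for all $a$. An $R$-module $V$ is an abelian monoid $(V,+)$ with a scalar multiplication $R\times V\to V$ satisfying the usual module axioms, including $1v=v$ and $0_Rv=0_V=a0_V$. For an additive (abelian) monoid $R$, write $x\le_R y$ if $x+d=y$ for some $d\in R$; $R$ is upper bound if $\le_R$ is antisymmetric; a semiring is upper bound if its additive monoid is. A submonoid $U$ of $(R,+)$ is almost subtractive in $R$ if for all $u,\tilde u\in U$ and $z,z'\in R$ with $u+z=u+z'=\tilde u$ one has $z=z'$. A map $q:V\to R$ is a quadratic form if $q(cx)=c^2q(x)$ for all $c\in R$, $x\in V$, and there exists a symmetric $R$-bilinear form $b:V\times V\to R$ (called a companion of $q$) with $q(x+y)=q(x)+q(y)+b(x,y)$ for all $x,y\in V$. The form $q$ is rigid if it has only one companion; a companion $b$ is balanced if $b(x,x)=2q(x)$ for all $x\in V$. *)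

(* Defs.v *)
From mathcomp Require Import all_boot all_algebra.

Set Implicit Arguments.
Unset Strict Implicit.
Unset Printing Implicit Defensive.

Import GRing.Theory.
Local Open Scope ring_scope.

(* A commutative semiring, possibly trivial, is a [comPzSemiRingType], and a
   module over it is an [lSemiModType]; for the latter, [a *: 0 = 0] is not an
   axiom of the structure but the lemma [scaler0].  Subsets are [Prop]-valued,
   so that no decidability of membership is assumed. *)

Section AdditiveMonoid.
Variable M : nmodType.
Implicit Types (U : M -> Prop) (x y z d : M).

Definition le_add x y : Prop := exists d, x + d = y.

Definition upper_bound_monoid : Prop :=
  forall x y, le_add x y -> le_add y x -> x = y.

Definition submonoid U : Prop :=
  U 0 /\ (forall x y, U x -> U y -> U (x + y)).

Definition almost_subtractive U : Prop :=
  forall u u' z z', U u -> U u' -> u + z = u' -> u + z' = u' -> z = z'.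

End AdditiveMonoid.

Definition upper_bound_semiring (R : comPzSemiRingType) : Prop :=
  upper_bound_monoid R.

Section QuadraticForms.
Variables (R : comPzSemiRingType) (V : lSemiModType R).
Implicit Types (q : V -> R) (b : V -> V -> R).

(* [bilinear_for] in the library is restricted to modules over rings. *)
Definition bilinear_form b : Prop :=
  [/\ forall x x' y, b (x + x') y = b x y + b x' y,
      forall x y y', b x (y + y') = b x y + b x y',
      forall c x y, b (c *: x) y = c * b x y
    & forall c x y, b x (c *: y) = c * b x y].

Definition companion q b : Prop :=
  [/\ bilinear_form b,
      forall x y, b x y = b y x
    & forall x y, q (x + y) = q x + q y + b x y].

Definition quadratic_form q : Prop :=
  (forall c x, q (c *: x) = c ^+ 2 * q x) /\ (exists b, companion q b).

Definition rigid q : Prop := exists! b, companion q b.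

Definition balanced q b : Prop := forall x, b x x = 2%:R * q x.

End QuadraticForms.

(* Main.v *)
(** If [b] is a companion of [q], then [b x y] solves [u + z = u'] with
    [u = q x + q y] and [u' = q (x + y)] both in [U], so it is determined by
    [q].  For [y = x] another solution is [2 * q x], because
    [q (x + x) = 4 * q x]. *)

Require Import Defs.
From mathcomp Require Import all_boot all_algebra.
From Stdlib Require Import FunctionalExtensionality.

Import GRing.Theory.
Local Open Scope ring_scope.

(** Here [z] is any element of [R], not necessarily a value of a companion, so that uniqueness and
    balance both follow from it. *)
Lemma companion_eq (R : comPzSemiRingType) (U : R -> Prop)
    (V : lSemiModType R) (q : V -> R) (b : V -> V -> R) (x y : V) (z : R) :
  submonoid U -> almost_subtractive U -> (forall x, U (q x)) ->
  companion q b -> q (x + y) = q x + q y + z -> b x y = z.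
Proof.
move=> [_ UD] Uas qU [_ _ qD] qz.
exact: (Uas (q x + q y) (q (x + y)) _ _ (UD _ _ (qU x) (qU y)) (qU _)
  (esym (qD x y)) (esym qz)).
Qed.

Lemma quadratic_form_double (R : comPzSemiRingType) (V : lSemiModType R)
    (q : V -> R) (x : V) :
  quadratic_form q -> q (x + x) = q x + q x + 2%:R * q x.
Proof.
move=> [qZ _].
(* Since [x + x] is [2%:R *: x], both sides become multiples of [q x], with [2 ^ 2] and [2 + 2]
   copies, equal by computation. *)
by rewrite -[x + x](scaler_nat 2 x) qZ -natrX !mulr_natl -(mulr2n (q x)) -mulrnDr.
Qed.

Local Close Scope ring_scope.

Theorem theorem1p2 (R : comPzSemiRingType) (hR : upper_bound_semiring R)
    (U : R -> Prop) (hU : submonoid U) (hUas : almost_subtractive U)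
    (V : lSemiModType R) (q : V -> R) (hq : quadratic_form q)
    (hqU : forall x : V, U (q x)) :
  rigid q /\ (forall b : V -> V -> R, companion q b -> balanced q b).
Proof.
split=> [|b cb x].
  have [_ [b cb]] := hq; exists b; split=> // b' [_ _ qD'].
  apply: functional_extensionality => x; apply: functional_extensionality => y.
  (* Take [z := b' x y], the value of the other companion. *)
  exact: (companion_eq _ _ _ _ _ x y _ hU hUas hqU cb (qD' x y)).
(* Balance is the diagonal case, with [z := 2%:R * q x]. *)
exact: (companion_eq _ _ _ _ _ x x _ hU hUas hqU cb
  (quadratic_form_double _ _ _ x hq)).
Qed.
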